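(* Let $D\subset\mathbb{R}$ be a set with $D\neq\mathbb{R}$ and $\operatorname{int}D\neq\emptyset$. If $D$ is periodic, then $D$ has a fundamental period. In particular, if $f$ is a periodic function with domain $D$, then $f$ has a fundamental period too; thus every two periods of $f$ are commensurable.
   Context: A set $D\subset\mathbb{R}$ is called $T$-periodic (or $T$-invariant), for a real $T\neq 0$, if $D+T=D$; it is periodic if this holds for some $T\ne 0$, and $T$ is then called a period of $D$. A function $f$ with domain $D\subset\mathbb{R}$ is called periodic (or $T$-periodic) if, for some real $T\neq0$, $D+T=D$ and $f(x+T)=f(x)$ for all $x\in D$; then $T$ is called a period of $f$. Periods are assumed positive. The smallest positive period of $f$ (or of $D$), if it exists, is called the fundamental period. Two nonzero real numbers are commensurable if their ratio is rational. $\operatorname{int}D$ is the interior of $D$ in $\mathbb{R}$. *)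

(* Defs.v *)
From HB Require Import structures.
From mathcomp Require Import all_boot all_order all_algebra.
From mathcomp Require Import all_classical all_reals all_analysis.
Set Implicit Arguments.
Unset Strict Implicit.
Unset Printing Implicit Defensive.
Import Order.TTheory GRing.Theory Num.Theory.
Import numFieldNormedType.Exports.
Local Open Scope classical_set_scope.
Local Open Scope ring_scope.

(* Periods are nonzero, of either sign; only the fundamental one is required
   to be positive. *)
Definition set_period (R : realType) (D : set R) (T : R) : Prop :=
  T != 0 /\ [set x + T | x in D] = D.

Definition periodic_set (R : realType) (D : set R) : Prop :=
  exists T : R, set_period D T.

(* f is defined on the subtype of the points of D, so f (x + T) is f at the
   point y of D whose value is x + T; such a y exists because D + T = D. *)
Definition fun_period (R : realType) (D : set R) (Y : Type) (f : D -> Y)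
    (T : R) : Prop :=
  set_period D T /\ forall x y : D, \val y = \val x + T -> f y = f x.

Definition periodic_fun (R : realType) (D : set R) (Y : Type) (f : D -> Y)
    : Prop :=
  exists T : R, fun_period f T.

(* P is the set of all periods of a set or of a function. *)
Definition is_fundamental_period (R : realType) (P : set R) (T : R) : Prop :=
  [/\ P T, 0 < T & forall S : R, P S -> 0 < S -> T <= S].

Definition commensurable (R : realType) (a b : R) : Prop :=
  [/\ a != 0, b != 0 & exists q : rat, a / b = ratr q].

(* Main.v *)
(* The periods of f, together with 0, form a subgroup G of R. If a period T were
   shorter than the radius of a ball contained in D, every real number could be
   moved into this ball by a multiple of T, so that D would be R. Hence G is a
   discrete subgroup of R, that is, an infinite cyclic one. The periodic set D
   is treated as the domain of a constant function. *)
Require Import Defs.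
From HB Require Import structures.
From mathcomp Require Import all_boot all_order all_algebra.
From mathcomp Require Import all_classical all_reals all_analysis.
From mathcomp Require Import lra.
Set Implicit Arguments.
Unset Strict Implicit.
Unset Printing Implicit Defensive.
Import Order.TTheory GRing.Theory Num.Theory.
Import numFieldNormedType.Exports.
Local Open Scope classical_set_scope.
Local Open Scope ring_scope.

Lemma floor_multiple (R : realType) (t x : R) : 0 < t ->
  exists n : int, t *~ n <= x < t *~ n + t.
Proof.
move=> t0; exists (Num.floor (x / t)).
rewrite -[X in _ + X]mulr1 -mulrzr -mulrDr mulrC [t * (_ + 1)]mulrC.
by rewrite -ler_pdivlMr// -ltr_pdivrMr// -(intrD _ _ 1) real_floor_itv ?num_real.
Qed.

(** The image equality contains both inclusions, so membership can be moved by T in either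
    direction. *)
Lemma set_periodE (R : realType) (D : set R) (T : R) :
  set_period D T <-> T != 0 /\ forall x, D (x + T) <-> D x.
Proof.
split=> [[T0 DT]|[T0 DT]]; split=> //.
  move=> x; split=> [|Dx]; last by rewrite -DT; exists x.
  by rewrite -{1}DT => -[y Dy /addIr <-].
apply/seteqP; split=> [_ [x Dx <-]|x Dx]; first exact/DT.
by exists (x - T); rewrite ?subrK//; apply/DT; rewrite subrK.
Qed.

Section Subgroup.
Variables (R : realType) (G : set R).
Hypotheses (G0 : G 0) (GB : forall x y, G x -> G y -> G (x - y)).

Lemma subgroupN x : G x -> G (- x).
Proof. by move=> Gx; rewrite -sub0r; exact: GB. Qed.

Lemma subgroupD x y : G x -> G y -> G (x + y).
Proof. by move=> Gx /subgroupN Gy; rewrite -[y]opprK; exact: GB. Qed.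

Lemma subgroupMz x (n : int) : G x -> G (x *~ n).
Proof.
move=> Gx; have GMn k : G (x *+ k).
  by elim: k => [|k IHk]; rewrite ?mulr0n// mulrS; exact: subgroupD.
by case: n => n; [exact: GMn | apply/subgroupN/GMn].
Qed.

(** Take t in [P] closer than [e] to [inf P]. A smaller positive y in [G] would make t - y a
    positive element below [e], so t is the least one. The remainder of x modulo t lies in [G] and
    in [0, t), hence vanishes. *)
Lemma discrete_subgroup_cyclic (e a : R) : 0 < e ->
  (forall x, G x -> 0 < x -> e <= x) -> G a -> a != 0 ->
  exists t, [/\ G t, 0 < t & forall x, G x -> exists n : int, x = t *~ n].
Proof.
move=> e0 Ge Ga a0; pose P := [set x | G x /\ 0 < x].
have Plb : has_lbound P by exists 0 => x [_ /ltW].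
have Pinf : has_inf P.
  split=> //; exists `|a|; split; last by rewrite normr_gt0.
  by case: (ler0P a) => _ //; exact: subgroupN.
have [t [Gt t0] tinf] := inf_adherent e0 Pinf.
have tmin y : G y -> 0 < y -> t <= y.
  move=> Gy y0; rewrite leNgt; apply/negP => yt.
  have infy : inf P <= y by apply: ge_inf.
  have := Ge (t - y) (GB Gt Gy); rewrite subr_gt0 => /(_ yt); lra.
exists t; split=> // x Gx; have [n /andP[le_x lt_x]] := floor_multiple x t0.
exists n; have Gr := GB Gx (subgroupMz n Gt).
move: le_x; rewrite le_eqVlt => /predU1P[//|].
rewrite -subr_gt0 => /(tmin _ Gr); lra.
Qed.

End Subgroup.

Lemma period_ge_radius (R : realType) (D : set R) (c e : R) :
  D <> setT -> ball c e `<=` D ->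
  forall T, set_period D T -> 0 < T -> e <= T.
Proof.
move=> DT ceD T /set_periodE[_ TD] T0; rewrite leNgt; apply/negP => Te.
apply: DT; apply/seteqP; split=> // y _.
have DMz (n : int) : forall x, D (x + T *~ n) <-> D x.
  have DMn k x : D (x + T *+ k) <-> D x.
    elim: k => [|k IHk]; first by rewrite mulr0n addr0.
    by rewrite mulrSr addrA TD.
  (* [Negz n] stands for -(n+1), whence the shift back by n+1 periods. *)
  by case: n => n x; [exact: DMn | rewrite -(DMn n.+1) NegzE mulrNz subrK].
(* The translate y - nT lies in [c, c + T), inside the ball since T < e. *)
have [n /andP[le_y lt_y]] := floor_multiple (y - c) T0.
rewrite -(DMz (- n)) mulrNz; apply: ceD.
by rewrite /ball /= ltr_norml; apply/andP; split; lra.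
Qed.

(** A generator gives both the least positive period and the commensurability of any two periods. *)
Lemma fun_periods_cyclic (R : realType) (D : set R) (Y : Type) (f : D -> Y) :
  D <> setT -> interior D <> set0 -> periodic_fun f ->
  exists t, [/\ fun_period f t, 0 < t &
    forall T, fun_period f T -> exists n : int, T = t *~ n].
Proof.
move=> DT /eqP/set0P[c /nbhs_ballP[e /= e0 ceD]] [T0 fT0].
pose G := [set T | T = 0 \/ fun_period f T].
(* This description of [G] covers T = 0 as well, so closure under subtraction needs no case S =
   T. *)
have GE T : G T <-> (forall x, D (x + T) <-> D x) /\
    forall x y : D, \val y = \val x + T -> f y = f x.
  split=> [[->|[/set_periodE[]//]]|[TD fT]].
    by split=> [x|x y]; rewrite addr0// => /val_inj ->.
  have [->|T_neq0] := eqVneq T 0; [by left | right; split=> //].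
  exact/set_periodE.
have GB S T : G S -> G T -> G (S - T).
  move=> /GE[SD fS] /GE[TD fT]; apply/GE.
  have TDN x : D (x - T) <-> D x by rewrite -TD subrK.
  split=> [x|x y yE]; first by rewrite addrA TDN SD.
  (* With z = x - T in D, we have x = z + T and y = z + S, so both values of f equal f z. *)
  have Dz : D (\val x - T) by apply/TDN/set_mem/valP.
  pose z : D := exist _ (\val x - T) (mem_set Dz).
  rewrite (fS z y); first by rewrite (fT z x)//= subrK.
  by rewrite yE /= addrAC addrA.
have Ge T : G T -> 0 < T -> e <= T.
  by move=> [->|[DT' _]]; [rewrite ltxx | exact: period_ge_radius ceD _ DT'].
have [t [Gt t0 tG]] :=
  @discrete_subgroup_cyclic R G (or_introl erefl) GB e T0 e0 Ge
    (or_intror fT0) fT0.1.1.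
exists t; split=> // [|T fT]; last by apply: tG; right.
by case: Gt => // t_eq0; rewrite t_eq0 ltxx in t0.
Qed.

Lemma fun_fundamental_period (R : realType) (D : set R) (Y : Type)
    (f : D -> Y) :
  D <> setT -> interior D <> set0 -> periodic_fun f ->
  exists T, is_fundamental_period (fun_period f) T.
Proof.
move=> DT D0 fP; have [t [ft t0 tf]] := fun_periods_cyclic DT D0 fP.
exists t; split=> // S /tf[n ->].
by rewrite pmulrz_rgt0// gtz0_ge1 => n1; rewrite -[leLHS]mulr1z ler_pMz2l.
Qed.

Theorem theoremB (R : realType) (D : set R)
    (D_neq_R : D <> [set: R]) (intD_neq0 : interior D <> set0) :
  (periodic_set D -> exists T : R, is_fundamental_period (set_period D) T) /\
  (forall (Y : Type) (f : D -> Y), periodic_fun f ->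
     (exists T : R, is_fundamental_period (fun_period f) T) /\
     (forall S T : R, fun_period f S -> fun_period f T -> commensurable S T)).
Proof.
split=> [[T0 DT0]|Y f fP].
  have cstE : fun_period (fun _ : D => tt) = set_period D.
    by apply/funext => T; apply/propext; split=> [[]|].
  rewrite -cstE; apply: fun_fundamental_period => //.
  by exists T0; rewrite cstE.
split=> [|S T fS fT]; first exact: fun_fundamental_period.
have [t [_ t0 tf]] := fun_periods_cyclic D_neq_R intD_neq0 fP.
split; [exact: fS.1.1 | exact: fT.1.1 |].
have [m ->] := tf _ fS; have [n ->] := tf _ fT.
(* The factor t cancels from the quotient of S = mt by T = nt. *)
exists (m%:~R / n%:~R); rewrite fmorph_div/= !ratr_int.
by rewrite -[t *~ m]mulrzr -[t *~ n]mulrzr -mulf_div divff ?gt_eqF// mul1r.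
Qed.
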